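(* Let $N\ge1$ and $t>0$. The number of fixed points $\tilde C_1$ satisfies $$\tilde C_1=t\left(1-\frac{t-1}{N+t-1}\right)+\sum_{l=1}^ND_l\tilde U_l^N+\sum_{l=2}^{N}\frac{t}{t+l-2}\,D_l\left(\sum_{k=1}^{l-1}\prod_{m=l}^N\mathbf 1_{(I_m\neq k)}\right)$$ $$=t\left(1-\frac{t-1}{N+t-1}\right)+\sum_{l=1}^N\left(\mathbf 1_{(I_l=l)}-\frac{t}{t+l-1}\right)\prod_{m=l+1}^N\mathbf 1_{(I_m\neq l)}$$ $$\qquad-\sum_{l=2}^{N}\frac{t}{t+l-2}\sum_{k=1}^{l-1}\left(\mathbf 1_{(I_l=k)}-\frac{1}{t+l-1}\right)\prod_{m=l+1}^N\mathbf 1_{(I_m\neq k)}.$$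
   Context: For $1\le k\le N$ let $\mathcal J_k=\{1,\dots,k\}$ and $\mathcal J=\mathcal J_1\times\cdots\times\mathcal J_N$ with coordinate maps $I_k:\mathcal J\to\mathcal J_k$. $\Gamma$ is the bijection from $\mathcal J$ to the symmetric group $\mathfrak S_N$ given by $\Gamma(i_1,\dots,i_N)=(N,i_N)\circ(N-1,i_{N-1})\circ\cdots\circ(2,i_2)$, where $(i,j)$ is the transposition of $i$ and $j$ (the identity if $i=j$). On $\mathcal J$ put the product measure $\mathbf P=\otimes_k\mathbf P_k$, where $\mathbf P_k(\{j\})=\frac1{t+k-1}$ for $j\in\mathcal J_k$, $j\ne k$, and $\mathbf P_k(\{k\})=\frac t{t+k-1}$ (the Ewens distribution of parameter $t$ on $\mathfrak S_N$ is the push-forward of $\mathbf P$ by $\Gamma$). $\tilde U^N_k$ is the indicator, as a function on $\mathcal J$, that $k$ is a fixed point of $\Gamma(I_1,\dots,I_N)$, and $\tilde C_1=\sum_{k=1}^N\tilde U_k^N$ is the number of fixed points of $\Gamma(I_1,\dots,I_N)$. For a function $F$ on $\mathcal J$, $D_lF=F-\mathbf E[F\,|\,I_m,\ m\neq l]$. Empty products equal $1$ and empty sums equal $0$. *)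

(* Defs.v *)
From mathcomp Require Import all_boot all_order all_algebra all_fingroup.
Set Implicit Arguments.
Unset Strict Implicit.
Unset Printing Implicit Defensive.
Import Order.TTheory GRing.Theory Num.Theory.
Local Open Scope ring_scope.

(* Indices are shifted by one: the ordinal k : 'I_N stands for the index k + 1
   in {1, ..., N}, and j : 'I_k.+1 stands for j + 1 in J_(k+1) = {1, ..., k+1}.
   Comparisons between indices and coordinates are unaffected; in numerical
   formulas the index is written k.+1%:R. *)

(* J = J_1 x ... x J_N; the coordinate map I_k is w |-> w k. *)
Definition Omega (N : nat) : finType := {dffun forall k : 'I_N, 'I_k.+1}.

(* [(s * u)%g x = u (s x)], so this product applies the transposition of index
   2 first: it is (N,i_N) \o ... \o (2,i_2). *)
Definition Gamma (N : nat) (w : Omega N) : 'S_N :=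
  (\prod_(k < N | (1 < k.+1)%N) tperm k (widen_ord (ltn_ord k) (w k)))%g.

Definition Pcoord (R : realFieldType) (t : R) (k : nat) (j : 'I_k.+1) : R :=
  if j == k :> nat then t / (t + k.+1%:R - 1) else 1 / (t + k.+1%:R - 1).

Definition Pr (R : realFieldType) (t : R) (N : nat) (w : Omega N) : R :=
  \prod_(k < N) Pcoord t (w k).

Definition agree_off (N : nat) (l : 'I_N) (w v : Omega N) : bool :=
  [forall m : 'I_N, (m != l) ==> (v m == w m)].

(* E[F | I_m, m != l] at w: the mean of F over the atom containing w of the
   sigma-algebra generated by the I_m, m != l. All atoms have positive
   probability when 0 < t. *)
Definition condE_off (R : realFieldType) (t : R) (N : nat) (l : 'I_N)
    (F : Omega N -> R) (w : Omega N) : R :=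
  (\sum_(v | agree_off l w v) Pr t v * F v) / (\sum_(v | agree_off l w v) Pr t v).

Definition D (R : realFieldType) (t : R) (N : nat) (l : 'I_N)
    (F : Omega N -> R) (w : Omega N) : R :=
  F w - condE_off t l F w.

Definition U (R : realFieldType) (N : nat) (k : 'I_N) (w : Omega N) : R :=
  (Gamma w k == k)%:R.

Definition C1 (R : realFieldType) (N : nat) (w : Omega N) : R :=
  \sum_(k < N) U R k w.

(* Main.v *)
(** The index k is fixed by Gamma exactly when I_k = k and I_m <> k for all
    m > k. Write A_l(k) for the indicator that I_m <> k for all m >= l. Since
    A_l(k) = 1_(I_l <> k) A_(l+1)(k), averaging over I_l alone gives
    D_l U_l = (1_(I_l = l) - t/(t+l-1)) A_(l+1)(l) and, for k < l,
    D_l A_l(k) = - (1_(I_l = k) - 1/(t+l-1)) A_(l+1)(k), which equals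
    A_l(k) - (t+l-2)/(t+l-1) A_(l+1)(k). Multiplied by t/(t+l-2) the latter
    telescopes in l, and the sum over l > k is t/(t+k-1) A_(k+1)(k) - t/(t+N-1).
    The A_(k+1)(k) terms cancel the compensators of the D_k U_k, and the constant
    left over is N t/(t+N-1) = t (1 - (t-1)/(N+t-1)). *)

Require Import Defs.
From mathcomp Require Import all_boot all_order all_algebra all_fingroup ring.
Import Order.TTheory GRing.Theory Num.Theory.
Local Open Scope ring_scope.

Section FixedPoints.

Set Implicit Arguments.
Unset Strict Implicit.

Variables (N : nat) (w : Omega N).

(** Indexed by [nat], with value 1 from [N] on, so that partial products can be handled by induction
    on their length. *)
Definition transp (i : nat) : 'S_N :=
  if insub i is Some k then tperm k (widen_ord (ltn_ord k) (w k)) else 1%g.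

Lemma transp_ord (k : 'I_N) : transp k = tperm k (widen_ord (ltn_ord k) (w k)).
Proof. by rewrite /transp valK. Qed.

(** The factor at 0, which [Gamma] omits, is trivial because ['I_1] has a single element. *)
Lemma Gamma_nat : Gamma w = (\prod_(0 <= i < N) transp i)%g.
Proof.
rewrite big_mkord /Gamma big_mkcond; apply: eq_bigr => k _.
rewrite transp_ord; case: ifPn => //; rewrite ltnS -leqNgt leqn0 => /eqP k0.
suff -> : widen_ord (ltn_ord k) (w k) = k by rewrite tperm1.
apply/val_inj => /=; move: (nat_of_ord (w k)) (ltn_ord (w k)) => j.
by rewrite k0; case: j.
Qed.

(** [transp i] moves only [i] and [w i <= i], both below [k] when [i < k]. *)
Lemma partial_below (k : 'I_N) (n : nat) :
  (n <= k)%N -> (\prod_(0 <= i < n) transp i)%g k = k.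
Proof.
elim: n => [|n IH] ltnk; first by rewrite big_geq // perm1.
have ltnN : (n < N)%N := ltn_trans ltnk (ltn_ord k).
rewrite big_nat_recr //= permM IH; last exact: ltnW.
rewrite (transp_ord (Ordinal ltnN)) tpermD // -val_eqE /= ltn_eqF //.
by apply: leq_trans (ltn_ord _) _.
Qed.

(* Once the transposition of index k has been applied, the image of k can only
   move up, to the index of the transposition being applied: it never comes
   back to k. *)
Lemma partial_above (R : realFieldType) (k : 'I_N) (n : nat) :
  (k < n)%N -> (n <= N)%N ->
  let q := (\prod_(0 <= i < n) transp i)%g k in
  (q < n)%N /\
  (q == k)%:R = (w k == k :> nat)%:R
                * \prod_(m < N | (k < m < n)%N) (w m != k :> nat)%:R :> R.
Proof.
elim: n => // n IH; rewrite ltnS leq_eqVlt => /predU1P[<- _|ltkn ltnN].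
  rewrite big_nat_recr //= permM partial_below // transp_ord tpermL /=.
  split; first exact: ltn_ord.
  rewrite big_pred0 ?mulr1; last by move=> m; rewrite ltnS; case: ltngtP.
  by rewrite -val_eqE.
rewrite big_nat_recr //= permM (transp_ord (Ordinal ltnN)).
have [] := IH ltkn (ltnW ltnN).
set q := (\prod_(0 <= i < n) transp i)%g k => ltqn eqq.
have -> : \prod_(m < N | (k < m < n.+1)%N) (w m != k :> nat)%:R
    = (w (Ordinal ltnN) != k :> nat)%:R
      * \prod_(m < N | (k < m < n)%N) (w m != k :> nat)%:R :> R.
  rewrite (bigD1 (Ordinal ltnN)) /= ?ltkn ?ltnSn //; congr (_ * _).
  apply: eq_bigl => m; rewrite -val_eqE /= -andbA; congr andb.
  by rewrite ltnS andbC -ltn_neqAle.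
(* The bound [q < n] excludes [q = n]. If [q] is the value of [w] at [n], its image is [n], and both
   sides vanish since [q = k] makes that value [k]. Otherwise [q] stays, and [q = k] forces the
   value to differ from [k]. *)
rewrite mulrCA -eqq; case: tpermP => [qn|qw|_ qw].
- by rewrite qn /= ltnn in ltqn.
- split; first exact: ltnSn.
  rewrite -!val_eqE qw /= gtn_eqF //.
  by case: eqP => _; rewrite ?mul0r ?mulr0.
- split; first exact: ltnW.
  case: eqVneq => [qk|_]; rewrite ?mulr0 // mulr1.
  suff -> : w (Ordinal ltnN) != k :> nat by [].
  by apply/eqP => wk; case: qw; apply/val_inj; rewrite /= qk wk.
Qed.

Lemma fixed_pointE (R : realFieldType) (k : 'I_N) :
  U R k w = (w k == k :> nat)%:R
            * \prod_(m < N | (k < m)%N) (w m != k :> nat)%:R.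
Proof.
rewrite /U Gamma_nat; have [_ ->] := partial_above R (ltn_ord k) (leqnn N).
by congr (_ * _); apply: eq_bigl => m; rewrite ltn_ord andbT.
Qed.

End FixedPoints.

Section Conditioning.

Set Implicit Arguments.
Unset Strict Implicit.

Variables (R : realFieldType) (t : R) (N : nat).
Hypothesis t_gt0 : 0 < t.

Definition update (w : Omega N) (l : 'I_N) (j : 'I_l.+1) : Omega N :=
  [ffun m => dfwith (fun k : 'I_N => w k) j m].

Lemma update_eq w (l : 'I_N) (j : 'I_l.+1) : update w j l = j.
Proof. by rewrite ffunE dfwith_in. Qed.

Lemma update_neq w (l m : 'I_N) (j : 'I_l.+1) : m != l -> update w j m = w m.
Proof. by move=> neq; rewrite ffunE dfwith_out // eq_sym. Qed.

Lemma denom_gt0 (k : nat) : 0 < t + k.+1%:R - 1.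
Proof. by rewrite -natr1 addrA addrK ltr_wpDr. Qed.

Lemma Pcoord_gt0 (k : nat) (j : 'I_k.+1) : 0 < Pcoord t j.
Proof. by rewrite /Pcoord; case: ifP => _; rewrite divr_gt0 ?denom_gt0. Qed.

Lemma sum_Pcoord (k : nat) : \sum_(j < k.+1) Pcoord t j = 1.
Proof.
have d0 := lt0r_neq0 (denom_gt0 k).
rewrite (bigD1 ord_max) //= {1}/Pcoord eqxx.
rewrite (eq_bigr (fun=> 1 / (t + k.+1%:R - 1))); last first.
  by move=> j; rewrite -val_eqE /Pcoord => /negPf /= ->.
rewrite sumr_const cardC1 card_ord -mulr_natl; field.
by rewrite nat1r.
Qed.

(** The atom of [w] is parametrized by its free coordinate: evaluation at [l] inverts [update]. *)
Lemma sum_agree_off (w : Omega N) (l : 'I_N) (F : Omega N -> R) :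
  \sum_(v | agree_off l w v) F v = \sum_(j < l.+1) F (update w j).
Proof.
rewrite (reindex_onto (update w (l := l)) (fun v : Omega N => v l)) /=;
  last first.
  move=> v /forallP agr; apply/ffunP => m.
  have [->|neq] := eqVneq m l; first by rewrite update_eq.
  by rewrite update_neq //; have /implyP/(_ neq)/eqP := agr m.
apply: eq_bigl => j; rewrite update_eq eqxx andbT.
by apply/forallP => m; apply/implyP => neq; rewrite update_neq.
Qed.

Lemma Pr_update (w : Omega N) (l : 'I_N) (j : 'I_l.+1) :
  Pr t (update w j) = Pcoord t j * \prod_(m < N | m != l) Pcoord t (w m).
Proof.
rewrite /Pr (bigD1 l) //= update_eq; congr (_ * _).
by apply: eq_bigr => m neq; rewrite update_neq.
Qed.

(** Independence: the weights of the other coordinates form a common positive factor [Q], which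
    cancels in the quotient. *)
Lemma condE_offE (w : Omega N) (l : 'I_N) (F : Omega N -> R) :
  condE_off t l F w = \sum_(j < l.+1) Pcoord t j * F (update w j).
Proof.
rewrite /condE_off !sum_agree_off.
set Q := \prod_(m < N | m != l) Pcoord t (w m).
have Q_gt0 : 0 < Q by apply: prodr_gt0 => m _; apply: Pcoord_gt0.
have -> : \sum_(j < l.+1) Pr t (update w j) = Q.
  under eq_bigr => j _ do rewrite Pr_update.
  by rewrite -mulr_suml sum_Pcoord mul1r.
under eq_bigr => j _ do rewrite Pr_update -/Q mulrAC.
by rewrite -mulr_suml mulfK // lt0r_neq0.
Qed.

Lemma avoid_update (w : Omega N) (l : 'I_N) (j : 'I_l.+1) (k : nat) :
  \prod_(m < N | (l < m)%N) (update w j m != k :> nat)%:R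
  = \prod_(m < N | (l < m)%N) (w m != k :> nat)%:R :> R.
Proof.
by apply: eq_bigr => m ltlm; rewrite update_neq // -val_eqE /= gtn_eqF.
Qed.

Lemma avoid_recl (w : Omega N) (l : 'I_N) (k : nat) :
  \prod_(m < N | (l <= m)%N) (w m != k :> nat)%:R
  = (w l != k :> nat)%:R * \prod_(m < N | (l < m)%N) (w m != k :> nat)%:R :> R.
Proof.
rewrite (bigD1 l) //=; congr (_ * _); apply: eq_bigl => m.
by rewrite -val_eqE /= ltn_neqAle eq_sym andbC.
Qed.

Lemma sum_Pcoord_eq (l : nat) (k : 'I_l.+1) :
  \sum_(j < l.+1) Pcoord t j * (j == k :> nat)%:R = Pcoord t k.
Proof.
rewrite (bigD1 k) //= eqxx mulr1 big1 ?addr0 // => j.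
by rewrite -val_eqE => /negPf /= ->; rewrite mulr0.
Qed.

Lemma D_fixed_point (w : Omega N) (l : 'I_N) :
  D t l (U R l) w
  = ((w l == l :> nat)%:R - t / (t + l.+1%:R - 1))
    * \prod_(m < N | (l < m)%N) (w m != l :> nat)%:R.
Proof.
rewrite /D condE_offE fixed_pointE mulrBl; congr (_ - _).
under eq_bigr => j _ do rewrite fixed_pointE update_eq avoid_update mulrA.
by rewrite -mulr_suml (sum_Pcoord_eq ord_max) /Pcoord eqxx.
Qed.

Lemma D_avoid (w : Omega N) (l : 'I_N) :
  D t l (fun v : Omega N =>
           \sum_(k < N | (k < l)%N)
             \prod_(m < N | (l <= m)%N) (v m != k :> nat)%:R) w
  = - \sum_(k < N | (k < l)%N)
        ((w l == k :> nat)%:R - 1 / (t + l.+1%:R - 1)) *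
        \prod_(m < N | (l < m)%N) (w m != k :> nat)%:R.
Proof.
rewrite /D condE_offE.
under [X in _ - X]eq_bigr => j _ do rewrite mulr_sumr.
rewrite exchange_big /= -sumrB -sumrN; apply: eq_bigr => k ltkl.
under [X in _ - X]eq_bigr => j _ do
  rewrite avoid_recl update_eq avoid_update mulrA.
have -> : \sum_(j < l.+1) Pcoord t j * (j != k :> nat)%:R
          * \prod_(m < N | (l < m)%N) (w m != k :> nat)%:R
    = (1 - 1 / (t + l.+1%:R - 1))
      * \prod_(m < N | (l < m)%N) (w m != k :> nat)%:R.
  rewrite -mulr_suml; congr (_ * _).
  have neqE (j : nat) : (j != k)%:R = 1 - (j == k)%:R :> R.
    by case: eqP => _ /=; rewrite ?subrr ?subr0.
  under eq_bigr => j _ do rewrite neqE mulrBr mulr1.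
  rewrite sumrB sum_Pcoord.
  (* As [k < l], the value [k] is not the top one of coordinate [l], so its weight has numerator 1
     and not [t]. *)
  have ltkl1 : (k < l.+1)%N := ltnW ltkl.
  by rewrite (sum_Pcoord_eq (Ordinal ltkl1)) /Pcoord /= ltn_eqF.
rewrite avoid_recl; case: eqP => _ /=; ring.
Qed.

Lemma telescope_avoid (w : Omega N) (k : 'I_N) :
  \sum_(l < N | (k < l)%N)
     t / (t + l.+1%:R - 2) *
     (((w l == k :> nat)%:R - 1 / (t + l.+1%:R - 1)) *
      \prod_(m < N | (l < m)%N) (w m != k :> nat)%:R)
  = t / (t + N%:R - 1)
    - t / (t + k.+1%:R - 1) *
      \prod_(m < N | (k < m)%N) (w m != k :> nat)%:R.
Proof.
(* The summand at [l] is [g l.+1 - g l], as the cases [w l = k] and [w l != k] show; in [g N] the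
   product is empty. *)
pose g (l : nat) : R :=
  t / (t + l%:R - 1) * \prod_(m < N | (l <= m)%N) (w m != k :> nat)%:R.
transitivity (g N - g k.+1); last first.
  rewrite /g [X in _ * X - _]big_pred0 ?mulr1 // => m.
  by rewrite leqNgt ltn_ord.
rewrite -(telescope_sumr g (ltn_ord k)) big_geq_mkord /=.
apply: eq_bigr => l ltkl; rewrite /g avoid_recl -natr1.
(* [k < l] gives [1 <= l], hence [t + l - 1 > 0]; at [l = 0] the denominator would be [t - 1], which
   may vanish. *)
have l1_ge0 : 0 <= l%:R - 1 :> R.
  by rewrite subr_ge0 ler1n (leq_ltn_trans _ ltkl).
have d0 : t + l%:R - 1 != 0 by rewrite lt0r_neq0 // -addrA ltr_wpDr.
have d1 : t + (l%:R + 1) - 1 != 0 by rewrite natr1 lt0r_neq0 // denom_gt0.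
by case: eqP => _ /=; field; rewrite d0 d1.
Qed.

End Conditioning.

Theorem theorem5p7 (R : realFieldType) (N : nat) (t : R)
    (hN : (1 <= N)%N) (ht : 0 < t) (w : Omega N) :
  C1 R w =
    t * (1 - (t - 1) / (N%:R + t - 1))
    + \sum_(l < N) D t l (U R l) w
    + \sum_(l < N | (2 <= l.+1)%N)
        t / (t + l.+1%:R - 2) *
        D t l (fun v : Omega N =>
                 \sum_(k < N | (k < l)%N)
                   \prod_(m < N | (l <= m)%N) (v m != k :> nat)%:R) w
  /\
  C1 R w =
    t * (1 - (t - 1) / (N%:R + t - 1))
    + \sum_(l < N)
        ((w l == l :> nat)%:R - t / (t + l.+1%:R - 1)) *
        \prod_(m < N | (l < m)%N) (w m != l :> nat)%:R
    - \sum_(l < N | (2 <= l.+1)%N)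
        t / (t + l.+1%:R - 2) *
        \sum_(k < N | (k < l)%N)
          ((w l == k :> nat)%:R - 1 / (t + l.+1%:R - 1)) *
          \prod_(m < N | (l < m)%N) (w m != k :> nat)%:R.
Proof.
rewrite (eq_bigr _ (fun l _ => D_fixed_point ht w l)).
rewrite (eq_bigr _ (fun l _ => congr1 ( *%R _) (D_avoid ht w l))).
under [X in _ = _ + _ + X /\ _]eq_bigr => l _ do rewrite mulrN.
rewrite sumrN.
set S := \sum_(l < N) _; set T := \sum_(l < N | _) _.
(* With every [D] evaluated, the two identities coincide. *)
suff E : C1 R w = t * (1 - (t - 1) / (N%:R + t - 1)) + S - T by split.
have -> : T = \sum_(k < N) (t / (t + N%:R - 1)
    - t / (t + k.+1%:R - 1) * \prod_(m < N | (k < m)%N) (w m != k :> nat)%:R).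
  rewrite /T; under eq_bigr => l _ do rewrite mulr_sumr.
  (* With [k] outermost, the restriction [2 <= l.+1] is implied by [k < l], and the inner sum
     telescopes. *)
  rewrite (exchange_big_dep xpredT) //=; apply: eq_bigr => k _.
  rewrite -telescope_avoid //; apply: eq_bigl => l.
  by rewrite ltnS; case: (nat_of_ord l).
rewrite sumrB sumr_const card_ord -mulr_natl.
have -> : S = C1 R w - \sum_(k < N) t / (t + k.+1%:R - 1)
    * \prod_(m < N | (k < m)%N) (w m != k :> nat)%:R.
  by rewrite /C1 -sumrB; apply: eq_bigr => k _; rewrite mulrBl fixed_pointE.
have d0 : t + N%:R - 1 != 0.
  by case: N hN {w S T} => // n _; rewrite lt0r_neq0 ?denom_gt0.
by field.
Qed.
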